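(* Let $0<\varepsilon\le1$, $0<\mu\le1$ and $C>0$ be constants. Let $A=(a_{ij})$ be an $n\times n$ real matrix and let $x_1,\dots,x_n,y_1,\dots,y_n$ be independent copies of $\eta^{\mu}$. Assume $$\rho_b^{(\mu)}(A):=\sup_{a\in\mathbb{R}}\mathbb{P}\Big(\sum_{i,j}a_{ij}x_iy_j=a\Big)\ge n^{-C}.$$ Then there exist a set $J_0$ of size $O_{C,\varepsilon,\mu}(1)$, a set $J$ of size $n-3n^{\varepsilon}$ with $J\cap J_0=\emptyset$, and a nonzero integer $l$ with $|l|\le n^{O_{C,\varepsilon,\mu}(1)}$, such that for every $j\in J$ there exist a proper symmetric GAP $P_j$ of rank $O_{C,\varepsilon,\mu}(1)$ and size $n^{O_{C,\varepsilon,\mu}(1)}$, an index set $I_j$ of size $n-n^{\varepsilon}$, and integers $l_{j_0j}$, $j_0\in J_0$, all of absolute value at most $n^{O_{C,\varepsilon,\mu}(1)}$, such that for all $i\in I_j$ $$\sum_{j_0\in J_0}l_{j_0j}a_{ij_0}+l\,a_{ij}\in P_j.$$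
   Context: For $0<\mu\le1$, $\eta^{\mu}$ takes values $1$ and $-1$ with probability $\mu/2$ each and $0$ with probability $1-\mu$. A symmetric GAP of rank $r$ is $\{m_1g_1+\dots+m_rg_r: m_h\in\mathbb{Z}, |m_h|\le N_h\}$ with real $g_h$, nonnegative integers $N_h$; proper means unique representation; size means cardinality. $O_{C,\varepsilon,\mu}(1)$ denotes a quantity bounded by a constant depending only on $C,\varepsilon,\mu$; asymptotics are as $n\to\infty$. *)

(* Defs.v *)
From HB Require Import structures.
From mathcomp Require Import all_boot all_order all_algebra.
From mathcomp Require Import all_classical all_reals all_analysis.

Set Implicit Arguments.
Unset Strict Implicit.
Unset Printing Implicit Defensive.

Import Order.TTheory GRing.Theory Num.Theory.
Import numFieldNormedType.Exports.

Local Open Scope classical_set_scope.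
Local Open Scope ring_scope.

Section probability.
Context {d : measure_display} {T : measurableType d} {R : realType}.
Variable P : probability T R.

(* The three probabilities add up to 1, so X is almost surely in {-1, 0, 1}. *)
Definition copy_of_eta (mu : R) (X : {RV P >-> R}) : Prop :=
  [/\ P (X @^-1` [set 1]) = (mu / 2)%:E,
      P (X @^-1` [set -1]) = (mu / 2)%:E
    & P (X @^-1` [set 0]) = (1 - mu)%:E].

Definition mutually_independent (I : finType) (X : I -> {RV P >-> R}) : Prop :=
  forall (S : {set I}) (B : I -> set R), (forall i, measurable (B i)) ->
    P (\bigcap_(i in [set` S]) (X i @^-1` B i)) =
    (\prod_(i in S) P (X i @^-1` B i))%E.

(* The 2n variables x_1, ..., x_n, y_1, ..., y_n as a single family. *)
Definition joint_family (n : nat) (x y : 'I_n -> {RV P >-> R})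
    (k : 'I_n + 'I_n) : {RV P >-> R} :=
  match k with inl i => x i | inr j => y j end.

Definition bilinear_concentration (n : nat) (A : 'M[R]_n)
    (x y : 'I_n -> {RV P >-> R}) : \bar R :=
  ereal_sup [set P [set w | \sum_(i < n) \sum_(j < n) A i j * x i w * y j w = a]
            | a in [set: R]].

End probability.

Record sym_gap (R : realType) := SymGap {
  gap_rank : nat;
  gap_gen : 'I_gap_rank -> R;
  gap_dim : 'I_gap_rank -> nat }.

Section gap.
Context {R : realType}.
Variable G : sym_gap R.

Definition gap_box : set ('I_(gap_rank G) -> int) :=
  [set m | forall h, (`|m h| <= gap_dim h)%N].

Definition gap_val (m : 'I_(gap_rank G) -> int) : R :=
  \sum_h (m h)%:~R * gap_gen h.

Definition gap_set : set R := gap_val @` gap_box.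

Definition gap_proper : Prop := set_inj gap_box gap_val.

(* In the %card scope, #<= compares cardinals and `I_s is {0, ..., s - 1}. *)
Definition gap_size_le (s : nat) : Prop := (gap_set #<= `I_s)%card.

End gap.

(* Main.v *)
Require Import Defs.
From HB Require Import structures.
From mathcomp Require Import all_boot all_order all_algebra.
From mathcomp Require Import all_classical all_reals all_analysis.
From mathcomp Require Import measurable_realfun ring lra zify.

(* The concentration of a sum of v_i eta_i is bounded by the value at 0 of the
   positive definite law f of a symmetrized partial sum. Adjoining v_i to the
   partial sum multiplies f(0) by at most 1 - c d as long as
   f(2 v_i) < (1 - d) f(0); with d a small negative power of n, a greedy choice
   stops after few steps. At that point the remaining 2 v_i form a set B with
   f >= f(0) / 2 on the k-fold sumset kB, k a small power of n, because
   sqrt(f(0) - f) is subadditive. Hence kB has polynomially many elements, and a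
   greedy choice in B produces boundedly many w_h such that all elements of B are
   combinations of the w_h with polynomially bounded integer coefficients and one
   common polynomially bounded denominator M.

   For the bilinear form, condition on x. With polynomially large probability
   the linear result applies to the numbers b_j = sum_i a_ij x_i; pigeonholing
   over x fixes M and the indices j_0 of the w_h, and then, for all but few j,
   also the coefficients in M b_j = sum_h m_h b_(j_h). This is a linear relation
   in x of polynomially large probability, so the linear result applies again,
   to the coefficients M a_ij - sum_h m_h a_(i, j_h). *)

Set Implicit Arguments.
Unset Strict Implicit.
Unset Printing Implicit Defensive.

Import Order.TTheory GRing.Theory Num.Theory.
Import numFieldNormedType.Exports.

Local Open Scope ring_scope.

(** * Positive definite functions *)

Section PosDef.
Variable R : realFieldType.
Implicit Types (f : R -> R) (x y a : R).

Definition posdef f := forall s : seq (R * R),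
  0 <= \sum_(p <- s) \sum_(q <- s) p.1 * q.1 * f (p.2 - q.2).

(** Grouping the pairs by their point [z] turns the quadratic form into a sum of squares of total
    weights. *)
Lemma posdef_delta0 : posdef (fun x => (x == 0)%:R).
Proof.
move=> s; set Z := undup [seq p.2 | p <- s].
suff -> : \sum_(p <- s) \sum_(q <- s) p.1 * q.1 * (p.2 - q.2 == 0)%:R
    = \sum_(z <- Z) (\sum_(p <- s) p.1 * (p.2 == z)%:R) ^+ 2.
  by apply: sumr_ge0 => z _; exact: sqr_ge0.
transitivity (\sum_(z <- Z) \sum_(p <- s) \sum_(q <- s)
    (p.1 * (p.2 == z)%:R) * (q.1 * (q.2 == z)%:R)); last first.
  apply: eq_bigr => z _; rewrite expr2 mulr_suml.
  by apply: eq_bigr => p _; rewrite mulr_sumr.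
rewrite [RHS]exchange_big /= big_seq [RHS]big_seq; apply: eq_bigr => p ps.
rewrite [RHS]exchange_big /=; apply: eq_bigr => q _.
have pZ : p.2 \in Z by rewrite mem_undup; apply: map_f.
rewrite (bigD1_seq p.2) ?undup_uniq //= eqxx mulr1 big1 => [|z /negbTE zp].
  by rewrite addr0 subr_eq0 [q.2 == _]eq_sym mulrA.
by rewrite eq_sym zp mulr0 mul0r.
Qed.

Section Theory.
Variable f : R -> R.
Hypotheses (f_pd : posdef f) (f_even : forall x, f (- x) = f x).

Lemma posdef_le0 x : f x <= f 0.
Proof.
have := f_pd [:: (1, x); (-1, 0)].
rewrite !big_cons !big_nil /= !subrr subr0 sub0r f_even; lra.
Qed.

(* Positivity of the quadratic form of f at the points 0, x, x + y with
   weights -1, m + 1, -m. *)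
Lemma posdef_defectD (m : nat) x y :
  m%:R * (f 0 - f (x + y)) <=
  m.+1%:R * (f 0 - f x) + m%:R * m.+1%:R * (f 0 - f y).
Proof.
have := f_pd [:: (-1, 0); (m.+1%:R, x); (- m%:R, x + y)].
rewrite !big_cons !big_nil /= !subrr subr0 !sub0r !f_even subr0.
have -> : x + y - x = y by rewrite addrC addKr.
have -> : x - (x + y) = - y by rewrite opprD addrA subrr sub0r.
rewrite f_even -natr1; set M := m%:R : R; nra.
Qed.

End Theory.
End PosDef.

(** * Laws of weighted sums of independent copies of eta^mu *)

Section Walk.
Variables (R : realFieldType) (mu : R).
Hypotheses (mu_ge0 : 0 <= mu) (mu_le1 : mu <= 1).

(* The outcomes 0, 1, 2 of 'I_3 encode the values -1, 0, 1 of eta^mu. *)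
Definition eta_val (c : 'I_3) : R := c%:R - 1.
Definition eta_wt (c : 'I_3) : R := if c == 1 :> nat then 1 - mu else mu / 2.

Lemma eta_wt_ge0 c : 0 <= eta_wt c.
Proof. rewrite /eta_wt; case: ifP => _; [by rewrite subr_ge0 | exact: divr_ge0]. Qed.

Lemma eta_wt_sum1 : \sum_c eta_wt c = 1.
Proof. rewrite !big_ord_recl big_ord0 /eta_wt /=; lra. Qed.

(** The probability that the sum of [a * eta] over the entries [a] of [s], with independent copies
    [eta], equals [x]; [symwalk] is the same for the difference of two independent such sums. *)
Fixpoint walk (s : seq R) (x : R) : R :=
  if s is a :: s' then \sum_c eta_wt c * walk s' (x - eta_val c * a)
  else (x == 0)%:R.

Fixpoint symwalk (s : seq R) (x : R) : R :=
  if s is a :: s' then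
    \sum_c \sum_c' eta_wt c * eta_wt c' *
      symwalk s' (x - (eta_val c - eta_val c') * a)
  else (x == 0)%:R.

Lemma symwalkN s x : symwalk s (- x) = symwalk s x.
Proof.
elim: s x => [|a s IH] x /=; first by rewrite oppr_eq0.
rewrite exchange_big; apply: eq_bigr => c _; apply: eq_bigr => c' _.
rewrite [eta_wt c' * _]mulrC -IH; congr (_ * symwalk _ _); ring.
Qed.

(** For [a :: s] the quadratic form at weighted points [p] is that of [symwalk s] at the points
    [p.2 - eta_val c * a] with weights [p.1 * eta_wt c]. *)
Lemma symwalk_posdef s : posdef (symwalk s).
Proof.
elim: s => [|a s IH]; first exact: posdef_delta0.
move=> l; have := IH [seq (p.1 * eta_wt c, p.2 - eta_val c * a)
  | p <- l, c <- enum 'I_3].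
rewrite big_allpairs_dep /=; set X := (X in 0 <= X -> _).
suff -> : X = \sum_(p <- l) \sum_(q <- l) p.1 * q.1 * symwalk (a :: s) (p.2 - q.2).
  by [].
apply: eq_bigr => p _; rewrite big_enum /=.
under eq_bigr => c _.
  rewrite big_allpairs_dep /=.
  under eq_bigr => q _ do rewrite big_enum /=.
  over.
rewrite exchange_big /=; apply: eq_bigr => q _.
rewrite mulr_sumr; apply: eq_bigr => c _; rewrite mulr_sumr.
apply: eq_bigr => c' _; rewrite mulrACA -!mulrA; do 4 congr (_ * _).
congr symwalk; ring.
Qed.

(** Serves to count the points at which the law is large. The induction averages over translates of
    [z], which stay duplicate-free. *)
Lemma symwalk_sum_le1 s (z : seq R) : uniq z -> \sum_(x <- z) symwalk s x <= 1.
Proof.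
elim: s z => [|a s IH] z uz /=.
  have [z0|z0] := boolP (0 \in z); last first.
    rewrite big_seq big1 ?ler01 // => x xz.
    by case: eqP xz z0 => // -> ->.
  rewrite (bigD1_seq 0) //= eqxx big1 ?addr0 // => x /negbTE ->; by [].
rewrite exchange_big -eta_wt_sum1 /=; apply: ler_sum => c _.
rewrite exchange_big -[leRHS]mulr1 -eta_wt_sum1 mulr_sumr /=.
apply: ler_sum => c' _; rewrite -mulr_sumr -[leRHS]mulr1.
rewrite ler_wpM2l ?mulr_ge0 ?eta_wt_ge0 //.
set k := _ * a; rewrite -(big_map (fun x => x - k) xpredT (symwalk s)).
by apply: IH; rewrite map_inj_uniq //; apply: addIr.
Qed.

(* P(X = v) P(X' = v - x) <= P(X - X' = x) for independent copies X, X'. *)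
Lemma walk_symwalk s v x : walk s v * walk s (v - x) <= symwalk s x.
Proof.
elim: s v x => [|a s IH] v x /=.
  have [->|_] := eqVneq v 0; last by rewrite mul0r ler0n.
  by rewrite sub0r oppr_eq0 mul1r.
rewrite mulr_suml; apply: ler_sum => c _; rewrite mulr_sumr.
apply: ler_sum => c' _; rewrite mulrACA ler_wpM2l ?mulr_ge0 ?eta_wt_ge0 //.
apply: le_trans (IH (v - eta_val c * a) _); rewrite le_eqVlt; apply/orP; left.
apply/eqP; congr (_ * walk _ _); ring.
Qed.

Lemma symwalk_swap a b s x : symwalk (a :: b :: s) x = symwalk (b :: a :: s) x.
Proof.
rewrite /=.
transitivity (\sum_c \sum_c' \sum_d \sum_d' eta_wt c * eta_wt c' *
  (eta_wt d * eta_wt d' * symwalk s (x - (eta_val c - eta_val c') * a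
      - (eta_val d - eta_val d') * b))).
  by do 2 (apply: eq_bigr => ? _); rewrite mulr_sumr; apply: eq_bigr => ? _; rewrite mulr_sumr.
transitivity (\sum_d \sum_d' \sum_c \sum_c' eta_wt c * eta_wt c' *
  (eta_wt d * eta_wt d' * symwalk s (x - (eta_val c - eta_val c') * a
      - (eta_val d - eta_val d') * b))).
  under eq_bigr => c _ do rewrite exchange_big /=.
  rewrite exchange_big /=; apply: eq_bigr => d _.
  under eq_bigr => c _ do rewrite exchange_big /=.
  by rewrite exchange_big.
do 2 (apply: eq_bigr => ? _); rewrite mulr_sumr; apply: eq_bigr => ? _; rewrite mulr_sumr.
by apply: eq_bigr => ? _; rewrite mulrCA [x - _ - _]addrAC.
Qed.

Lemma symwalk_cons_congr a s s' : symwalk s =1 symwalk s' ->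
  symwalk (a :: s) =1 symwalk (a :: s').
Proof. by move=> e x /=; do 2 (apply: eq_bigr => ? _); rewrite e. Qed.

Lemma symwalk_catCA s1 s2 s3 :
  symwalk (s1 ++ s2 ++ s3) =1 symwalk (s2 ++ s1 ++ s3).
Proof.
have middle a s s' : symwalk (s ++ a :: s') =1 symwalk (a :: s ++ s').
  elim: s => [|b s IH] x //.
  by rewrite !cat_cons (symwalk_cons_congr b IH) symwalk_swap.
elim: s1 => [|a s1 IH] x //.
by rewrite !cat_cons (symwalk_cons_congr a IH) -middle.
Qed.

(** Allows any subfamily to be moved to the end of the list, where [symwalk_cat_le] applies. *)
Lemma symwalk_perm s s' : perm_eq s s' -> symwalk s =1 symwalk s'.
Proof.
move=> ss'; apply: (catCA_perm_ind _ ss' (P := fun t => symwalk s =1 symwalk t)) => //.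
by move=> s1 s2 s3 e x; rewrite e symwalk_catCA.
Qed.

(** The left side is an average of terms that are nonnegative by [posdef_le0]. Only the outcomes
    (-1, 1) and (1, -1) are kept: they have weight mu^2/4 each and shift by [2 * a] up to sign. *)
Lemma symwalk_cons_defect a s : symwalk s 0 - symwalk (a :: s) 0 >=
  mu ^+ 2 / 2 * (symwalk s 0 - symwalk s (2 * a)).
Proof.
have -> : symwalk s 0 - symwalk (a :: s) 0 = \sum_c \sum_c' eta_wt c * eta_wt c' *
    (symwalk s 0 - symwalk s (0 - (eta_val c - eta_val c') * a)).
  rewrite /= -[X in X - _ = _]mul1r -{1}eta_wt_sum1 mulr_suml -sumrB.
  apply: eq_bigr => c _; rewrite -[X in X * symwalk _ _]mulr1 -{1}eta_wt_sum1.
  rewrite mulr_sumr mulr_suml -sumrB; apply: eq_bigr => c' _; ring.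
pose F c c' := eta_wt c * eta_wt c' *
    (symwalk s 0 - symwalk s (0 - (eta_val c - eta_val c') * a)).
have F_ge0 c c' : 0 <= F c c'.
  rewrite !mulr_ge0 ?eta_wt_ge0 // subr_ge0.
  exact: (posdef_le0 (@symwalk_posdef s) (symwalkN s)).
have outer (G : 'I_3 -> R) : (forall c, 0 <= G c) -> G ord0 + G ord_max <= \sum_c G c.
  move=> G_ge0; rewrite (bigD1 ord0) //= (bigD1 ord_max) //= addrA lerDl.
  by apply: sumr_ge0 => c _.
apply: le_trans (outer _ _) => [|c]; last by apply: sumr_ge0 => c' _; exact: F_ge0.
have lb c c' : F c c' <= \sum_d F c d.
  by rewrite (bigD1 c') //= lerDl; apply: sumr_ge0 => d _.
apply: le_trans (lerD (lb ord0 ord_max) (lb ord_max ord0)).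
rewrite /F /eta_wt /eta_val /=.
have -> : 0 - (0%:R - 1 - (2%:R - 1)) * a = 2 * a by ring.
have -> : 0 - (2%:R - 1 - (0%:R - 1)) * a = - (2 * a) by ring.
rewrite symwalkN le_eqVlt; apply/orP; left; apply/eqP; by field.
Qed.

Lemma symwalk_cat_le s s' : symwalk (s ++ s') 0 <= symwalk s' 0.
Proof.
elim: s => //= a s; apply: le_trans.
rewrite -subr_ge0; apply: le_trans (symwalk_cons_defect a (s ++ s')).
rewrite mulr_ge0 ?divr_ge0 ?sqr_ge0 ?ler0n // subr_ge0.
exact: (posdef_le0 (@symwalk_posdef _) (symwalkN _)).
Qed.

End Walk.

(** * Integer relations in a set with small iterated sumsets *)

Section SmallSumset.
Variables (R : realFieldType) (I : Type) (beta : I -> R) (B : I -> Prop).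

Definition diffs (Q : seq R) := [seq q - q' | q <- Q, q' <- Q].

Lemma diffsP (Q : seq R) v :
  reflect (exists q q', [/\ q \in Q, q' \in Q & v = q - q']) (v \in diffs Q).
Proof.
apply: (iffP allpairsP) => [[[q q'] /= [? ? ->]]|[q [q' [? ? ->]]]].
  by exists q, q'.
by exists (q, q').
Qed.

(** [h] and [m] are total on [nat], so that a generator is appended by redefining [h] at [r],
    without change of type. *)
Definition coordinates (h : nat -> I) (r M D : nat) (v : R) :=
  exists2 m : nat -> int, forall x, (`|m x| <= D)%N &
    M%:R * v = \sum_(x < r) (m x)%:~R * beta (h x).

Section Step.
Variables (T : nat) (Q : seq R) (i : I).
Hypotheses (T_gt1 : (1 < T)%N) (iQ : beta i \notin diffs Q).

(** Take the least positive multiplier that reaches [T] or brings [beta i] into [diffs Q]; it is not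
    1, by [T_gt1] and [iQ]. *)
Lemma exists_multiple : exists t : nat,
  [/\ (1 < t <= T)%N, (t == T) || (t%:R * beta i \in diffs Q) &
      forall s, (0 < s < t)%N -> s%:R * beta i \notin diffs Q].
Proof.
pose p n := (0 < n)%N && ((T <= n)%N || (n%:R * beta i \in diffs Q)).
have pT : p T by rewrite /p leqnn; apply/andP; split => //; lia.
have exp : exists n, p n by exists T.
case: (ex_minnP exp) => t /andP[t_gt0 tQ] t_min.
have tT : (t <= T)%N by exact: t_min.
exists t; split.
- rewrite tT andbT ltn_neqAle t_gt0 andbT; apply/eqP => t1; move: tQ.
  by rewrite -t1 mul1r (negbTE iQ) orbF leqNgt T_gt1.
- by rewrite eqn_leq tT.
- move=> s /andP[s_gt0 st]; apply/negP => sQ.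
  by have := t_min s; rewrite /p s_gt0 sQ orbT => /(_ isT); rewrite leqNgt st.
Qed.

Definition thicken t := [seq q + s%:R * beta i | q <- Q, s <- iota 0 t].

(** A coincidence with multipliers [s' < s] would put [(s - s') * beta i] into [diffs Q]. *)
Lemma thicken_uniq t : uniq Q ->
  (forall s, (0 < s < t)%N -> s%:R * beta i \notin diffs Q) -> uniq (thicken t).
Proof.
move=> Q_uniq t_min; apply: allpairs_uniq => //; first exact: iota_uniq.
have aux q s q' s' : q \in Q -> q' \in Q -> (s < t)%N -> (s' < s)%N ->
    q + s%:R * beta i = q' + s'%:R * beta i -> False.
  move=> qQ q'Q st ss e; have /negP[] := t_min (s - s')%N ltac:(lia).
  apply/diffsP; exists q', q; split => //.
  by rewrite natrB ?(ltnW ss) // mulrBl; lra.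
move=> [q s] [q' s'] /allpairsP[[a b] /= [aQ bt [-> ->]]].
move=> /allpairsP[[a' b'] /= [aQ' bt' [-> ->]]] e.
rewrite !mem_iota !add0n /= in bt bt'.
case: (ltngtP b b') => bb.
- by case: (aux _ _ _ _ aQ' aQ bt' bb (esym e)).
- by case: (aux _ _ _ _ aQ aQ' bt bb e).
- by move: e; rewrite bb => /addIr ->.
Qed.

Lemma size_thicken t : size (thicken t) = (size Q * t)%N.
Proof. by rewrite size_allpairs size_iota. Qed.

Lemma thicken_diffs t v : v \in diffs (thicken t) ->
  exists c : int, exists w, [/\ (`|c| <= t)%N, w \in diffs Q & v = w + c%:~R * beta i].
Proof.
move=> /diffsP[_ [_ [/allpairsP[[q s] /= [qQ st ->]] /allpairsP[[q' s'] /= [qQ' st' ->]] ->]]].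
rewrite !mem_iota !add0n /= in st st'.
exists (s%:Z - s'%:Z), (q - q'); split; first by lia.
  by apply/diffsP; exists q, q'.
rewrite rmorphB /= !pmulrn; ring.
Qed.

(** No generator is added: for [v = w + c * beta i], [t * M * v] equals
    [t * (M * w) + c * (M * (t * beta i))], and both [w] and [t * beta i] already have
    coordinates. *)
Lemma coordinates_torsion t h r M D : t%:R * beta i \in diffs Q ->
  (forall v, v \in diffs Q -> coordinates h r M D v) ->
  forall v, v \in diffs (thicken t) -> coordinates h r (t * M) (2 * t * D) v.
Proof.
move=> tQ co v /thicken_diffs[c [w [ct /co[m mD mw] ->]]].
have [m' mD' mw'] := co _ tQ.
exists (fun x => t%:Z * m x + c * m' x) => [x|].
  have := mD x; have := mD' x; nia.
transitivity (t%:R * (M%:R * w) + c%:~R * (M%:R * (t%:R * beta i))).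
  by rewrite natrM; ring.
rewrite mw mw' !mulr_sumr -big_split /=; apply: eq_bigr => x _.
rewrite rmorphD !rmorphM /= !pmulrn; ring.
Qed.

Lemma coordinates_free t h r M D :
  (forall v, v \in diffs Q -> coordinates h r M D v) ->
  forall v, v \in diffs (thicken t) ->
    coordinates (fun x => if x == r then i else h x) r.+1 M (D + M * t) v.
Proof.
move=> co v /thicken_diffs[c [w [ct /co[m mD mw] ->]]].
exists (fun x => if x == r then M%:Z * c else m x) => [x|].
  case: eqP => _; last by have := mD x; lia.
  have := mD 0%N; nia.
rewrite big_ord_recr /= eqxx mulrDr mw rmorphM /= -pmulrn mulrA; congr (_ + _).
by apply: eq_bigr => x _; rewrite (ltn_eqF (ltn_ord x)).
Qed.

End Step.

Variables (H : nat -> R -> Prop) (i0 : I) (N T k J : nat).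
Hypotheses (H0 : H 0%N 0) (HS : forall m x, H m x -> H m.+1 x)
  (HD : forall m x i, H m x -> B i -> H m.+1 (x + beta i)).
Hypothesis HN : forall s : seq R, uniq s -> (forall x, x \in s -> H k x) ->
  (size s <= N)%N.
Hypotheses (T_gt1 : (1 < T)%N) (JTk : (J * T <= k)%N) (NJ : (N < 2 ^ J)%N).

(** By [H0], [HS] and [HD], [H m] contains all sums of at most [m] of the [beta i] with [B i].
    Passing to [thicken Q i t] multiplies [size Q] by [t] and [M] by at most [t], and adds a
    generator only if [t = T]; hence [size Q] controls [M], [T ^ r] and [D] throughout. *)
Definition stage j (Q : seq R) (h : nat -> I) (r M D : nat) :=
  [/\ uniq Q, forall x, x \in Q -> H (j * T) x & (2 ^ j <= size Q)%N] /\
  [/\ (0 < M <= size Q)%N, (T ^ r <= size Q)%N, (D <= size Q ^ 2 * T)%N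
    & forall v, v \in diffs Q -> coordinates h r M D v].

Lemma H_leq m m' x : (m <= m')%N -> H m x -> H m' x.
Proof. by move=> /subnK <-; elim: (_ - _)%N => // n IH /IH /HS. Qed.

Lemma stage_step j Q h r M D i : stage j Q h r M D -> B i ->
  beta i \notin diffs Q -> exists Q' h' r' M' D', stage j.+1 Q' h' r' M' D'.
Proof.
move=> [[Qu QH Q2] [/andP[M0 MQ] TQ DQ co]] Bi iQ.
have [t [/andP[t1 tT] tQ t_min]] := exists_multiple T_gt1 iQ.
have st : [/\ uniq (thicken Q i t), forall x, x \in thicken Q i t -> H (j.+1 * T) x &
    (2 ^ j.+1 <= size (thicken Q i t))%N].
  split; first exact: thicken_uniq.
    move=> _ /allpairsP[[q s] /= [qQ st ->]].
    rewrite mem_iota add0n /= in st.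
    apply: (@H_leq (j * T + s)); first by rewrite mulSn; lia.
    elim: s {st} => [|s IH]; first by rewrite mul0r addr0 addn0; exact: QH.
    by rewrite -natr1 mulrDl mul1r addrA addnS; exact: HD.
  by rewrite size_thicken expnSr leq_mul.
have [/eqP tE|tnT] := boolP (t == T).
  exists (thicken Q i t), (fun x => if x == r then i else h x), r.+1, M, (D + M * t)%N.
  split=> //; rewrite size_thicken; split; last exact: coordinates_free.
  - by rewrite M0 /=; nia.
  - by rewrite expnSr tE leq_mul.
  (* Both [D] and [M * T] are at most [q ^ 2 * T], and [T >= 2] lets their sum fit into
     [(q * T) ^ 2 * T]. *)
  - rewrite tE; move: DQ MQ T_gt1; set q := size Q => DQ MQ T1.
    have q_gt0 : (0 < q)%N := leq_trans M0 MQ.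
    have Mq2 : (M <= q ^ 2)%N by rewrite -mulnn (leq_trans MQ) ?leq_pmulr.
    apply: (@leq_trans (2 * (q ^ 2 * T))).
      by rewrite mul2n -addnn leq_add // leq_mul2r Mq2 orbT.
    by rewrite expnMn mulnAC mulnC leq_mul2l -mulnn; apply/orP; right; nia.
exists (thicken Q i t), h, r, (t * M)%N, (2 * t * D)%N.
rewrite (negbTE tnT) /= in tQ.
split=> //; rewrite size_thicken; split; last exact: coordinates_torsion.
- by rewrite muln_gt0 M0 mulnC leq_mul // andbT; lia.
- by apply: leq_trans TQ _; rewrite leq_pmulr //; lia.
- apply: (@leq_trans (t * t * (size Q ^ 2 * T))).
    by rewrite leq_mul // leq_mul2r t1 orbT.
  by rewrite expnMn mulnn mulnCA mulnA.
Qed.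

(* Greedily enlarge Q = {sum_l s_l b_l : 0 <= s_l < t_l}, whose sums are
   distinct: either t_l reaches the cap T, which happens only boundedly often
   and yields a free generator, or t_l b_l lies in the previous Q - Q and
   contributes only to the common denominator M. *)
Lemma small_sumset_coordinates : exists (h : nat -> I) (r M : nat),
  [/\ (0 < M <= N)%N, (T ^ r <= N)%N &
      forall i, B i -> coordinates h r M (N ^ 2 * T) (beta i)].
Proof.
have bound j Q h r M D : (j <= J)%N -> stage j Q h r M D -> (size Q <= N)%N.
  move=> jJ [[Qu QH _] _]; apply: HN => // x /QH; apply: H_leq.
  by apply: leq_trans JTk; rewrite leq_mul.
have [//|neg] := EM (exists (h : nat -> I) (r M : nat),
  [/\ (0 < M <= N)%N, (T ^ r <= N)%N &
      forall i, B i -> coordinates h r M (N ^ 2 * T) (beta i)]).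
(* Under [neg] some [beta i] escapes [diffs Q] at every stage, so stage [J] is reached; there
   [2 ^ J <= size Q <= N] contradicts [NJ]. *)
have all_stages j : (j <= J)%N -> exists Q h r M D, stage j Q h r M D.
  elim: j => [_|j IH jJ].
    exists [:: 0], (fun=> i0), 0%N, 1%N, 0%N; split; split=> //.
      by move=> x; rewrite inE => /eqP ->.
    move=> v /diffsP[q [q']]; rewrite !inE => -[/eqP -> /eqP -> ->].
    by exists (fun=> 0) => //; rewrite big_ord0 subrr mulr0.
  have [Q [h [r [M [D st]]]]] := IH (ltnW jJ).
  have QN := bound _ _ _ _ _ _ (ltnW jJ) st.
  have [[i Bi iQ]|all_in] := EM (exists2 i, B i & beta i \notin diffs Q).
    exact: stage_step st Bi iQ.
  case: neg; exists h, r, M; case: st => _ [/andP[M0 MQ] TQ DQ co]; split.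
  - by rewrite M0 (leq_trans MQ).
  - exact: leq_trans QN.
  - move=> i Bi; have [|iQ] := boolP (beta i \in diffs Q); last first.
      by case: all_in; exists i.
    move=> /co[m mD e]; exists m => // x; apply: leq_trans (mD x) _.
    by apply: leq_trans DQ _; rewrite leq_mul2r leq_sqr QN orbT.
have [Q [h [r [M [D st]]]]] := all_stages J (leqnn J).
have := bound _ _ _ _ _ _ (leqnn J) st; case: st => -[_ _ Q2] _.
lia.
Qed.

End SmallSumset.

(** * The inverse theorem for linear forms *)

Section LinearInverse.
Variables (R : realType) (mu : R).
Hypotheses (mu_gt0 : 0 < mu) (mu_le1 : mu <= 1).

Let mu_ge0 : 0 <= mu := ltW mu_gt0.

Section Greedy.
Variables (n : nat) (v : 'I_n -> R) (a rho delta : R) (s : nat).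
Hypotheses (rho_gt0 : 0 < rho) (delta_ge0 : 0 <= delta) (delta_le1 : delta <= 1).
Hypothesis walk_ge : rho <= walk mu [seq v i | i <- enum 'I_n] a.

Let law (l : seq 'I_n) := symwalk mu [seq v i | i <- l].

(** Dropping entries cannot lower the value at 0, and for the full list this value is at least the
    probability that two independent copies both hit [a]. *)
Lemma symwalk_sub_ge (l : seq 'I_n) : uniq l -> rho ^+ 2 <= law l 0.
Proof.
move=> ul.
have pl : perm_eq (enum 'I_n) ([seq i <- enum 'I_n | i \notin l] ++ l).
  apply: uniq_perm; rewrite ?enum_uniq //.
    rewrite cat_uniq filter_uniq ?enum_uniq // ul andbT.
    by apply/hasPn => i il; rewrite mem_filter il.
  by move=> i; rewrite mem_enum mem_cat mem_filter mem_enum andbT orNb.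
apply: le_trans (symwalk_cat_le mu_ge0 mu_le1 [seq v i | i <- enum 'I_n & i \notin l] _).
rewrite -map_cat -(symwalk_perm mu (perm_map v pl)).
apply: le_trans (walk_symwalk mu_ge0 mu_le1 _ a 0); rewrite subr0 expr2.
by rewrite ler_pM // ltW.
Qed.

Hypothesis small : (1 - mu ^+ 2 / 2 * delta) ^+ s < rho ^+ 2.

(** Otherwise a list can be extended [s] times, each time multiplying [law l 0] by at most
    [1 - mu ^+ 2 / 2 * delta], starting from 1; [small] then contradicts [symwalk_sub_ge]. *)
Lemma greedy_subset : exists2 l : seq 'I_n, uniq l /\ (size l <= s)%N &
  forall i, i \notin l -> law l 0 - law l (2 * v i) <= delta * law l 0.
Proof.
have musq : 0 <= mu ^+ 2 / 2 <= 1.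
  by have := exprn_ile1 2 mu_ge0 mu_le1; have := sqr_ge0 mu; lra.
have x_le1 : mu ^+ 2 / 2 * delta <= 1 by case/andP: musq => ? ?; exact: mulr_ile1.
apply: contrapT => none.
have grow t : (t <= s)%N -> exists l : seq 'I_n, [/\ uniq l, size l = t &
    law l 0 <= (1 - mu ^+ 2 / 2 * delta) ^+ t].
  elim: t => [_|t IH ts]; first by exists [::]; rewrite /law /= eqxx.
  have [l [ul lt le]] := IH (ltnW ts).
  have [i il di] : exists2 i, i \notin l & delta * law l 0 < law l 0 - law l (2 * v i).
    apply: contrapT => nope; apply: none; exists l; first by rewrite lt ltnW.
    move=> i il; rewrite leNgt; apply/negP => di; apply: nope; by exists i.
  exists (i :: l); rewrite /= il lt; split=> //.
  have := symwalk_cons_defect mu_ge0 mu_le1 (v i) [seq v i | i <- l].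
  rewrite -/(law l) -/(law (i :: l)) => dec.
  have : mu ^+ 2 / 2 * (delta * law l 0) <=
      mu ^+ 2 / 2 * (law l 0 - law l (2 * v i)).
    by rewrite ler_wpM2l ?(ltW di) //; case/andP: musq.
  rewrite (exprS _ t); have : 0 <= 1 - mu ^+ 2 / 2 * delta by rewrite subr_ge0.
  move: dec le; set x := mu ^+ 2 / 2 in musq *; set y := _ ^+ t.
  move=> dec le x1 le2; apply: (@le_trans _ _ ((1 - x * delta) * law l 0)).
    by lra.
  by rewrite ler_wpM2l.
have [l [ul _ le]] := grow s (leqnn s).
by have := lt_le_trans small (symwalk_sub_ge ul); rewrite ltNge le.
Qed.

Lemma linear_inverse_param (N T k J : nat) : (0 < n)%N ->
  k.+1%:R ^+ 2 * delta <= 1 / 2 -> 2 / rho ^+ 2 <= N%:R ->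
  (1 < T)%N -> (J * T <= k)%N -> (N < 2 ^ J)%N ->
  exists E : {set 'I_n}, (#|E| <= s)%N /\
  exists (h : nat -> 'I_n) (r M : nat), [/\ (0 < M <= N)%N, (T ^ r <= N)%N &
    forall i, i \notin E -> coordinates v h r M (N ^ 2 * T) (v i)].
Proof.
move=> n_gt0 kd rhoN T1 JTk NJ.
have [l [ul ls] lP] := greedy_subset.
exists [set i in l]; split; first by rewrite cardsE (leq_trans (card_size _)).
set F := law l 0 in lP.
have F_ge : rho ^+ 2 <= F := symwalk_sub_ge ul.
have F_gt0 : 0 < F by apply: lt_le_trans F_ge; rewrite exprn_gt0.
(* Defects of [m]-fold sums grow like [m ^ 2]. Starting from [m.+1] keeps the factor on the left of
   [posdef_defectD] nonzero at level 0. *)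
pose H (m : nat) x := F - law l x <= m.+1%:R ^+ 2 * delta * F.
have dF : 0 <= delta * F by rewrite mulr_ge0 // ltW.
have H0 : H 0%N 0 by rewrite /H subrr expr1n mul1r.
have HS m x : H m x -> H m.+1 x.
  have mm : m.+1%:R ^+ 2 <= m.+2%:R ^+ 2 :> R by rewrite ler_sqr ?nnegrE ?ler0n // ler_nat.
  by rewrite /H => Hx; have := ler_wpM2r dF mm; lra.
have HD m x i : H m x -> i \notin l -> H m.+1 (x + 2 * v i).
  rewrite /H => Hx il; have := lP _ il.
  move=> Hi.
  have := posdef_defectD (@symwalk_posdef _ mu _)
    (@symwalkN _ mu [seq v i | i <- l]) m.+1 x (2 * v i).
  move: Hx; rewrite -/(law l) -/F -[m.+2%:R]natr1; set w := m.+1%:R => Hx main.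
  have w_gt0 : 0 < w by rewrite ltr0n.
  rewrite -(ler_pM2l w_gt0); apply: le_trans main _.
  have h1 := ler_wpM2l (ltW (addr_gt0 w_gt0 ltr01)) Hx.
  have h2 := ler_wpM2l (ltW (mulr_gt0 w_gt0 (addr_gt0 w_gt0 ltr01))) Hi.
  apply: le_trans (lerD h1 h2) _; rewrite le_eqVlt; apply/orP; left; apply/eqP; ring.
(* On level [k] the law is at least [F / 2], so total mass at most 1 leaves room for at most
   [2 / F <= 2 / rho ^+ 2] points. *)
have HN (z : seq R) : uniq z -> (forall x, x \in z -> H k x) -> (size z <= N)%N.
  move=> uz zH; rewrite -(ler_nat R); apply: le_trans rhoN.
  have : (size z)%:R * (F / 2) <= 1.
    apply: le_trans (symwalk_sum_le1 mu_ge0 mu_le1 [seq v i | i <- l] uz).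
    have -> : (size z)%:R * (F / 2) = \sum_(x <- z) (F / 2).
      by rewrite big_const_seq count_predT iter_addr_0 mulr_natl.
    rewrite big_seq [leRHS]big_seq.
    apply: ler_sum => x /zH; rewrite /H -/(law l) => Hx.
    have := ler_wpM2r (ltW F_gt0) kd; lra.
  rewrite ler_pdivlMr ?exprn_gt0 // => zF.
  have : (size z)%:R * rho ^+ 2 <= (size z)%:R * F by rewrite ler_wpM2l.
  lra.
(* Here [beta i] is [2 * v i], and the factor 2 is cancelled below; [Ordinal n_gt0] is the default
   generator. *)
have [h [r [M [MN Tr co]]]] := small_sumset_coordinates (Ordinal n_gt0) H0 HS HD HN T1 JTk NJ.
exists h, r, M; split=> // i; rewrite inE => /co[m mD e]; exists m => //.
have two : (2 : R) != 0 by rewrite pnatr_eq0.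
apply: (mulfI two); rewrite mulrCA e mulr_sumr; apply: eq_bigr => x _; ring.
Qed.

End Greedy.

(** Bounds [(1 - x) ^+ m] by [1 / (1 + m * x)]. The induction rests on
    [(1 - x) * (1 + m.+1 * x) <= 1 + m * x]. *)
Lemma expr_oneBr_le (x : R) m : 0 <= x <= 1 -> (1 - x) ^+ m * (1 + m%:R * x) <= 1.
Proof.
move=> /andP[x0 x1]; elim: m => [|m IH]; first by rewrite expr0 mul0r addr0 mulr1.
apply: le_trans IH; rewrite exprSr -mulrA ler_wpM2l ?exprn_ge0 ?subr_ge0 //.
rewrite -natr1; have : 0 <= m%:R * x * x by rewrite !mulr_ge0.
by have := mulr_ge0 x0 x0; lra.
Qed.

(* All scales are powers of one parameter p: T = p, k = (2c+1) p^2,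
   delta = 1/(8 k^2) and N = p^(2c+1). *)
Theorem linear_inverse (c : nat) : exists p0 : nat, forall p, (p0 <= p)%N ->
  forall n (v : 'I_n -> R) (a : R), (0 < n)%N ->
  p%:R ^- c <= walk mu [seq v i | i <- enum 'I_n] a ->
  exists E : {set 'I_n}, (#|E| <= p ^ 6)%N /\
  exists (h : nat -> 'I_n) (r M : nat),
    [/\ (0 < M <= p ^ (2 * c).+1)%N, (r <= (2 * c).+1)%N &
    forall i, i \notin E -> coordinates v h r M (p ^ (4 * c + 3)) (v i)].
Proof.
pose q := (2 * c).+1.
(* With this [kappa], a block of [kappa * p ^ 5] greedy steps brings the decay factor below [1 / p].
   Using [q] such blocks suffices, and [q * kappa <= p] keeps the number of steps at most
   [p ^ 6]. *)
pose kappa := Num.bound (16 * q%:R ^+ 2 / mu ^+ 2).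
have mu2_gt0 : 0 < mu ^+ 2 by rewrite exprn_gt0.
have kappaP : 16 * q%:R ^+ 2 <= kappa%:R * mu ^+ 2.
  rewrite -ler_pdivrMr // ltW // archi_boundP //.
  by rewrite divr_ge0 ?mulr_ge0 ?exprn_ge0 ?ler0n // ltW.
exists (maxn 2 (q * kappa)) => p; rewrite geq_max => /andP[p2 pk] n v a n_gt0 walk_ge.
have p_gt0 : (0 : R) < p%:R by rewrite ltr0n; lia.
have q_gt0 : (0 : R) < q%:R by rewrite ltr0n.
pose k := (q * p ^ 2)%N.
pose delta : R := (8 * k%:R ^+ 2)^-1.
have k_ge1 : (1 : R) <= k%:R by rewrite ler1n muln_gt0 expn_gt0; lia.
have k2_ge1 : (1 : R) <= k%:R ^+ 2 by rewrite exprn_ege1.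
have delta_gt0 : 0 < delta by rewrite invr_gt0; lra.
have delta_le1 : delta <= 1 by rewrite invf_le1; lra.
have rho_gt0 : (0 : R) < p%:R ^- c by rewrite invr_gt0 exprn_gt0.
have rho2 : (p%:R ^- c) ^+ 2 = (p%:R^-1 : R) ^+ (2 * c) by rewrite -exprVn -exprM mulnC.
(* With [J = q * p] one has [J * T = k], and [p < 2 ^ p] gives [N = p ^ q < 2 ^ J]. *)
have [||||||E [Es [h [r [M [MN Tr co]]]]]] := @linear_inverse_param n v a (p%:R ^- c) delta
  (kappa * p ^ 5 * q) rho_gt0 (ltW delta_gt0) delta_le1 walk_ge _ (p ^ q) p k (q * p) n_gt0.
- set x := mu ^+ 2 / 2 * delta.
  have x01 : 0 <= x <= 1.
    have musq : 0 <= mu ^+ 2 / 2 <= 1.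
      by have := exprn_ile1 2 mu_ge0 mu_le1; have := sqr_ge0 mu; lra.
    have d0 := ltW delta_gt0; case/andP: musq => ? ?.
    by apply/andP; split; [exact: mulr_ge0 | exact: mulr_ile1].
  have big : p%:R <= (kappa * p ^ 5)%:R * x.
    have -> : (kappa * p ^ 5)%:R * x = p%:R * (kappa%:R * mu ^+ 2 / (16 * q%:R ^+ 2)).
      rewrite /x /delta /k natrM natrX natrM natrX.
      have p0 := lt0r_neq0 p_gt0; have q0 := lt0r_neq0 q_gt0.
      by field; rewrite p0 q0.
    rewrite ler_peMr ?ler0n // ler_pdivlMr ?mul1r //.
    by rewrite mulr_gt0 ?exprn_gt0.
  have small : (1 - x) ^+ (kappa * p ^ 5) < p%:R^-1.
    have := expr_oneBr_le (kappa * p ^ 5) x01.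
    rewrite -ler_pdivlMr; last by lra.
    move=> le; apply: le_lt_trans le _; rewrite div1r ltf_pV2 ?posrE; lra.
  rewrite rho2 exprM.
  have pow : ((1 - x) ^+ (kappa * p ^ 5)) ^+ q < p%:R^-1 ^+ q.
    rewrite ltrXn2r // exprn_ge0 //; case/andP: x01 => _ ?; lra.
  apply: lt_le_trans pow _; rewrite /q exprS ler_piMl ?exprn_ge0 ?invr_ge0 //.
  by rewrite invf_le1 // ler1n ltnW.
- have kk : (k.+1%:R : R) ^+ 2 <= 4 * k%:R ^+ 2 by rewrite -natr1; nra.
  move: kk k2_ge1; rewrite /delta; set k2 := k%:R ^+ 2 => kk k2_ge1.
  by rewrite ler_pdivrMr; [clear -kk; lra | clear -k2_ge1; lra].
- rewrite rho2 exprVn invrK natrX /q exprS.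
  by rewrite ler_wpM2r ?exprn_ge0 // ler_nat.
- by [].
- by rewrite /k -mulnA mulnn.
- by rewrite mulnC expnM ltn_exp2r // ltn_expl.
exists E; split.
  apply: leq_trans Es _; rewrite mulnC mulnA expnS leq_mul2r pk; exact: orbT.
exists h, r, M; split=> //; first by rewrite -(leq_exp2l _ _ p2).
move=> i /co; rewrite -expnM -expnSr.
by have -> : (q * 2).+1 = (4 * c + 3)%N by rewrite /q; clear; lia.
Qed.

End LinearInverse.

(** * Splitting off the first coordinate of a finite function *)

Section FfunCons.
Variable T : finType.

Definition ffun_cons n (c : T) (u : {ffun 'I_n -> T}) : {ffun 'I_n.+1 -> T} :=
  [ffun i => oapp u c (unlift ord0 i)].

Lemma ffun_cons0 n c (u : {ffun 'I_n -> T}) : ffun_cons c u ord0 = c.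
Proof. by rewrite ffunE unlift_none. Qed.

Lemma ffun_consS n c (u : {ffun 'I_n -> T}) i : ffun_cons c u (lift ord0 i) = u i.
Proof. by rewrite ffunE liftK. Qed.

Lemma sum_ffun_cons (R : nmodType) n (F : {ffun 'I_n.+1 -> T} -> R) :
  \sum_u F u = \sum_c \sum_u F (ffun_cons c u).
Proof.
rewrite pair_big /=.
rewrite (reindex (fun p : T * {ffun 'I_n -> T} => ffun_cons p.1 p.2)) //=.
exists (fun u => (u ord0, [ffun i => u (lift ord0 i)])) => [[c u]|u] _ /=.
  by rewrite ffun_cons0; congr pair; apply/ffunP => i; rewrite ffunE ffun_consS.
apply/ffunP => i; case: (unliftP ord0 i) => [j|] ->; last by rewrite ffun_cons0.
by rewrite ffun_consS ffunE.
Qed.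

End FfunCons.

(** * Pigeonholing and finite encodings of coefficients *)

Section Counting.
Variable R : realType.

(** The events [Q _ x] cover [G], so they cannot all have weight below [s / #|X|]. *)
Lemma pigeonhole (U X : finType) (w : U -> R) (G : pred U) (Q : U -> X -> bool) s :
  (forall u, 0 <= w u) -> 0 < s -> s <= \sum_(u | G u) w u ->
  (forall u, G u -> exists x, Q u x) ->
  exists x, s <= #|X|%:R * \sum_(u | Q u x) w u.
Proof.
move=> w_ge0 s_gt0 sG GQ; apply: contrapT => none.
have lt x : #|X|%:R * \sum_(u | Q u x) w u < s.
  by rewrite ltNge; apply/negP => le; apply: none; exists x.
have le : \sum_(u | G u) w u <= \sum_x \sum_(u | Q u x) w u.
  under [leRHS]eq_bigr => x _ do rewrite big_mkcond /=.
  rewrite exchange_big big_mkcond /=; apply: ler_sum => u _.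
  case: ifP => [/GQ[x ux]|_]; last by apply: sumr_ge0 => x _; case: ifP.
  rewrite (bigD1 x) //= ux lerDl; apply: sumr_ge0 => y _; by case: ifP.
(* If [X] is empty, so is [G], against [0 < s]. *)
have [x0|x0] := pickP (fun _ : X => true); last first.
  move: sG; rewrite leNgt => /negP; apply.
  rewrite big1 // => u /GQ[x]; by have := x0 x.
have X_gt0 : (0 : R) < #|X|%:R by rewrite ltr0n; apply/card_gt0P; exists x0.
have : #|X|%:R * \sum_x \sum_(u | Q u x) w u < #|X|%:R * s.
  have -> : #|X|%:R * s = \sum_(x : X) s by rewrite mulr_natl sumr_const.
  rewrite mulr_sumr (bigD1 x0) //= [ltRHS](bigD1 x0) //=.
  by rewrite ltr_leD ?lt // ler_sum // => x _; exact/ltW/lt.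
by rewrite ltr_pM2l // ltNge (le_trans sG).
Qed.

(** Padding with zeros makes the number of generators independent of the outcome, as the
    pigeonholing requires. *)
Lemma coordinates_widen (I : Type) (beta : I -> R) h r r' M D x : (r <= r')%N ->
  coordinates beta h r M D x -> coordinates beta h r' M D x.
Proof.
move=> rr [m mD e]; exists (fun y => if (y < r)%N then m y else 0) => [y|].
  by case: ifP.
rewrite e (big_ord_widen r' (fun x => (m x)%:~R * beta (h x))) // big_mkcond.
by apply: eq_bigr => y _ /=; case: ifP; rewrite ?mul0r.
Qed.

(** Shifting by [D] places the coefficient vector in a finite type, over which one can
    pigeonhole. *)
Lemma coordinates_ffun (I : Type) (beta : I -> R) h r M D x :
  coordinates beta h r M D x -> exists m : {ffun 'I_r -> 'I_(2 * D).+1},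
    M%:R * x = \sum_y ((m y)%:Z - D%:Z)%:~R * beta (h y).
Proof.
move=> [m mD ->]; exists [ffun y : 'I_r => inord `|m y + D%:Z|].
apply: eq_bigr => y _; rewrite ffunE inordK; last by have := mD y; lia.
by congr (_ %:~R * _); have := mD y; lia.
Qed.

End Counting.

(** * The finite probability space of outcomes *)

Section Outcomes.
Variables (R : realType) (mu : R).
Hypotheses (mu_gt0 : 0 < mu) (mu_le1 : mu <= 1).

Let mu_ge0 : 0 <= mu := ltW mu_gt0.

Definition weight n (u : {ffun 'I_n -> 'I_3}) : R := \prod_i eta_wt mu (u i).
Definition form n (v : 'I_n -> R) (u : {ffun 'I_n -> 'I_3}) : R :=
  \sum_i v i * eta_val R (u i).

Lemma weight_ge0 n (u : {ffun 'I_n -> 'I_3}) : 0 <= weight u.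
Proof. by apply: prodr_ge0 => i _; exact: eta_wt_ge0. Qed.

Lemma weight_sum1 n : \sum_(u : {ffun 'I_n -> 'I_3}) weight u = 1.
Proof.
rewrite -(bigA_distr_bigA (fun _ => eta_wt mu)) big1 // => i _.
exact: eta_wt_sum1.
Qed.

Lemma walkE n (v : 'I_n -> R) a :
  walk mu [seq v i | i <- enum 'I_n] a = \sum_(u | form v u == a) weight u.
Proof.
rewrite big_mkcond /=; elim: n v a => [|n IH] v a.
  rewrite enum_ord0 /= (bigD1 [ffun i => ord0]) //= big1 => [|u /eqP[]].
    by rewrite addr0 /form /weight !big_ord0 eq_sym; case: eqP.
  by apply/ffunP => -[].
rewrite enum_ordSl /= sum_ffun_cons; apply: eq_bigr => c _.
rewrite -map_comp IH mulr_sumr; apply: eq_bigr => u _.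
rewrite /form /weight !big_ord_recl ffun_cons0 /=.
under [X in _ = if _ + X == _ then _ else _]eq_bigr => i _ do rewrite ffun_consS.
under [X in _ = if _ then _ * X else _]eq_bigr => i _ do rewrite ffun_consS.
rewrite eq_sym subr_eq eq_sym addrC [eta_val _ _ * _]mulrC.
by case: ifP; rewrite ?mulr0.
Qed.

End Outcomes.

(** * Averaging and double counting *)

Section Averaging.
Variable R : realType.

(** A pigeonhole over at most [p ^ c'] cases costs [c'] in the exponent. *)
Lemma invX_le_trans (p c c' : nat) (s t : R) (X : nat) : (1 < p)%N -> (X <= p ^ c')%N ->
  p%:R ^- c <= s -> s <= X%:R * t -> 0 <= t -> p%:R ^- (c + c') <= t.
Proof.
move=> p1 Xp ps st t_ge0.
have p_gt0 : (0 : R) < p%:R by rewrite ltr0n ltnW.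
rewrite exprD invfM ler_pdivrMr ?exprn_gt0 // (le_trans ps) // (le_trans st) //.
by rewrite mulrC ler_wpM2l // -natrX ler_nat.
Qed.

(** The outcomes with [F u < s / 2] contribute at most [s / 2] to the mean. *)
Lemma sum_large_ge (U : finType) (w F : U -> R) s :
  (forall u, 0 <= w u) -> \sum_u w u = 1 -> (forall u, F u <= 1) -> 0 <= s ->
  s <= \sum_u w u * F u -> s / 2 <= \sum_(u | s / 2 <= F u) w u.
Proof.
move=> w_ge0 w1 F1 s_ge0 sF.
have : \sum_u w u * F u <= \sum_(u | s / 2 <= F u) w u + s / 2.
  rewrite (bigID (fun u => s / 2 <= F u)) /=; apply: lerD.
    by apply: ler_sum => u _; rewrite ler_piMr.
  apply: (@le_trans _ _ (\sum_u w u * (s / 2))); last by rewrite -mulr_suml w1 mul1r.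
  rewrite [leRHS](bigID (fun u => s / 2 <= F u)) /=.
  rewrite -[leLHS]add0r lerD //.
    by apply: sumr_ge0 => u _; rewrite mulr_ge0 ?divr_ge0.
  by apply: ler_sum => u; rewrite -ltNge => /ltW Fu; exact: ler_wpM2l.
by lra.
Qed.

(** Double counting: summed over [j], the weights of the events [j \in E u] within [S] total at most
    [e] times the weight of [S], while each heavy [j] takes more than half of that weight. *)
Lemma few_heavy (U J : finType) (w : U -> R) (S : pred U) (E : U -> {set J}) e :
  (forall u, 0 <= w u) -> 0 < \sum_(u | S u) w u ->
  (forall u, S u -> (#|E u| <= e)%N) ->
  (#|[set j | ((\sum_(u | S u) w u) / 2 < \sum_(u | S u && (j \in E u)) w u)%R]|
     <= 2 * e)%N.
Proof.
set s := \sum_(u | _) _ => w_ge0 s_gt0 Ee; set B := [set j | _].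
have : #|B|%:R * (s / 2) <= e%:R * s.
  apply: (@le_trans _ _ (\sum_j \sum_(u | S u && (j \in E u)) w u)).
    have -> : #|B|%:R * (s / 2) = \sum_(j in B) s / 2 by rewrite mulr_natl sumr_const.
    rewrite [leRHS](bigID (mem B)) /= -[leLHS]addr0 lerD //.
      by apply: ler_sum => j; rewrite inE => /ltW.
    by apply: sumr_ge0 => j _; apply: sumr_ge0.
  under eq_bigr => j _ do rewrite big_mkcondr /=.
  rewrite exchange_big /= mulr_sumr; apply: ler_sum => u Su.
  by rewrite -big_mkcond sumr_const -[leLHS]mulr_natl ler_wpM2r // ler_nat Ee.
move=> Bs; rewrite -(ler_nat R) natrM -(ler_pM2r s_gt0); lra.
Qed.

End Averaging.

(** * The inverse theorem for bilinear forms *)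

Section BilinearInverse.
Variables (R : realType) (mu : R).
Hypotheses (mu_gt0 : 0 < mu) (mu_le1 : mu <= 1).

Let mu_ge0 : 0 <= mu := ltW mu_gt0.

(** [M] and [h] are common to all columns, whereas [m], [E], [h'], [r] and [M'] depend on [j]. [M']
    is later divided into the real generators, so only its positivity is recorded. *)
Definition columns_in_small_gaps n (A : 'M[R]_n) (p K : nat) :=
  exists (b M : nat) (h : 'I_b -> 'I_n) (bad : {set 'I_n}),
  [/\ (b <= K)%N, (0 < M <= p ^ K)%N, (#|bad| <= 2 * p ^ 6)%N &
  forall j, j \notin bad -> exists (m : 'I_b -> int),
    (forall x, `|m x| <= p ^ K)%N /\
    exists (E : {set 'I_n}) (h' : nat -> 'I_n) (r M' : nat),
    [/\ (#|E| <= p ^ 6)%N, (0 < M')%N, (r <= K)%N &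
    let v i := M%:R * A i j - \sum_x (m x)%:~R * A i (h x) in
    forall i, i \notin E -> coordinates v h' r M' (p ^ K) (v i)]].

Definition weight_bilinear n (A : 'M[R]_n) z : R :=
  \sum_u weight mu u * \sum_(v | form (fun j => form (A^~ j) u) v == z) weight mu v.

Theorem bilinear_inverse (c d : nat) : exists p0 K : nat, forall p, (p0 <= p)%N ->
  forall n (A : 'M[R]_n) (z : R), (0 < n <= p ^ d)%N ->
  p%:R ^- c <= weight_bilinear A z -> columns_in_small_gaps A p K.
Proof.
(* [b] bounds the rank in the first use of the linear result. There are at most [p ^ (d * b)]
   choices of [h], [p ^ b.+1] of [M] and [p ^ ((D0 + 2) * b)] of the coefficients; the increments in
   [c.+1] and [c2.+1] pay for factors 1/2. *)
pose b := (2 * c.+1).+1; pose c2 := (c.+1 + (d * b + b.+1))%N.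
pose D0 := (4 * c.+1 + 3)%N.
pose c3 := (c2.+1 + (D0 + 2) * b)%N.
have [p1 inv1] := linear_inverse mu_gt0 mu_le1 c.+1.
have [p2 inv2] := linear_inverse mu_gt0 mu_le1 c3.
pose K := (b + D0 + (2 * c3).+1 + (4 * c3 + 3))%N.
exists (maxn 2 (maxn p1 p2)), K => p; rewrite !geq_max => /and3P[p_gt1 pp1 pp2].
move=> n A z /andP[n_gt0 npd] conc.
have p_gt0 : (0 < p)%N := ltnW p_gt1.
have pR_gt0 : (0 : R) < p%:R by rewrite ltr0n.
have leK e : (e <= K)%N -> (p ^ e <= p ^ K)%N by move=> ?; rewrite leq_pexp2l.
pose col (u : {ffun 'I_n -> 'I_3}) j := form (A^~ j) u.
pose w : {ffun 'I_n -> 'I_3} -> R := weight mu (n := n).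
have w_ge0 u : 0 <= w u := weight_ge0 mu_gt0 mu_le1 u.
pose inner u := \sum_(v | form (col u) v == z) w v.
have inner_le1 u : inner u <= 1.
  rewrite -(weight_sum1 mu n) [leRHS](bigID (fun v => form (col u) v == z)) /=.
  by rewrite lerDl; apply: sumr_ge0.
have rho_gt0 : (0 : R) < p%:R ^- c by rewrite invr_gt0 exprn_gt0.
have good := sum_large_ge w_ge0 (weight_sum1 mu n) inner_le1 (ltW rho_gt0) conc.
have half_ge e : p%:R ^- e.+1 <= p%:R ^- e / 2 :> R.
  rewrite exprSr invfM ler_wpM2l ?invr_ge0 ?exprn_ge0 // lef_pV2 ?posrE //.
  by rewrite ler_nat.
pose Ecol u (hM : {ffun 'I_b -> 'I_n} * 'I_(p ^ b).+1) : {set 'I_n} :=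
  [set j | ~~ `[< exists m : {ffun 'I_b -> 'I_(2 * p ^ D0).+1},
    hM.2%:R * col u j = \sum_x ((m x)%:Z - (p ^ D0)%:Z)%:~R * col u (hM.1 x) >]].
pose Q u (hM : {ffun 'I_b -> 'I_n} * 'I_(p ^ b).+1) := (0 < hM.2)%N && (#|Ecol u hM| <= p ^ 6)%N.
have goodQ u : p%:R ^- c / 2 <= inner u -> exists hM, Q u hM.
  move=> /(le_trans (half_ge c)); rewrite /inner -walkE // => conc_u.
  have [E [Ep [h [r [M [/andP[M0 Mp] rb co]]]]]] := inv1 p pp1 n (col u) z n_gt0 conc_u.
  exists ([ffun x : 'I_b => h x], Ordinal (Mp : (M < (p ^ b).+1)%N)).
  rewrite /Q /= M0 (leq_trans _ Ep) // subset_leq_card //; apply/fintype.subsetP => j.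
  apply: contraTT => jE; rewrite inE negbK; apply/asboolP.
  have [m e] := coordinates_ffun (coordinates_widen rb (co j jE)).
  by exists m; rewrite /= e; apply: eq_bigr => x _; rewrite ffunE.
have s_gt0 : 0 < p%:R ^- c / 2 :> R by rewrite divr_gt0.
(* First pigeonhole: [h] and [M] no longer depend on the outcome, on a set [S] of large weight. *)
have [[h M] SM] := pigeonhole w_ge0 s_gt0 good goodQ.
pose S u := Q u (h, M); rewrite -/(S _) in SM.
set wS := \sum_(u | _) w u in SM.
have wS_ge : p%:R ^- c2 <= wS.
  apply: (invX_le_trans p_gt1 _ (half_ge c) SM); last by apply: sumr_ge0.
  rewrite card_prod card_ffun !card_ord expnD expnM leq_mul ?leq_exp2r //.
  by rewrite ltn_exp2l.
have wS_gt0 : 0 < wS by apply: lt_le_trans wS_ge; rewrite invr_gt0 exprn_gt0.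
have SE u : S u -> (#|Ecol u (h, M)| <= p ^ 6)%N by case/andP.
have M_gt0 : (0 < M)%N.
  rewrite lt0n; apply/negP => /eqP M0; move: wS_gt0.
  by rewrite /wS big1 ?ltxx // => u; rewrite /S /Q /= M0.
exists b, (M : nat), h, [set j | wS / 2 < \sum_(u | S u && (j \in Ecol u (h, M))) w u].
split; [by rewrite /K -!addnA leq_addr | | exact: few_heavy |].
  rewrite M_gt0 (leq_trans (ltn_ord M : (M <= p ^ b)%N)) // leK //.
  by rewrite /K -!addnA leq_addr.
move=> j; rewrite inE -leNgt => j_light.
have rest : wS / 2 <= \sum_(u | S u && (j \notin Ecol u (h, M))) w u.
  have : wS = \sum_(u | S u && (j \in Ecol u (h, M))) w u +
      \sum_(u | S u && (j \notin Ecol u (h, M))) w u by rewrite /wS -bigID.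
  by move: j_light; clear; lra.
pose rel u (m : {ffun 'I_b -> 'I_(2 * p ^ D0).+1}) :=
  M%:R * col u j == \sum_x ((m x)%:Z - (p ^ D0)%:Z)%:~R * col u (h x).
have relP u : S u && (j \notin Ecol u (h, M)) -> exists m, rel u m.
  by move=> /andP[_]; rewrite inE negbK => /asboolP[m e]; exists m; apply/eqP.
have wS2_gt0 : 0 < wS / 2 by rewrite divr_gt0.
(* Second pigeonhole, for a fixed light [j]: one coefficient vector [m] serves many outcomes. *)
have [m relm] := pigeonhole w_ge0 wS2_gt0 rest relP.
(* The relation says that the linear form in x with coefficients [v] vanishes, so the linear result
   applies again, at the value 0. *)
pose v i := M%:R * A i j - \sum_x ((m x)%:Z - (p ^ D0)%:Z)%:~R * A i (h x).
have formv u : form v u = M%:R * col u j -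
    \sum_x ((m x)%:Z - (p ^ D0)%:Z)%:~R * col u (h x).
  rewrite /col /form mulr_sumr.
  under [X in _ = _ - X]eq_bigr => x _ do rewrite mulr_sumr.
  rewrite exchange_big /= -sumrB; apply: eq_bigr => i _.
  rewrite mulrBl mulrA mulr_suml; congr (_ - _); apply: eq_bigr => x _.
  by rewrite mulrA.
have conc_v : p%:R ^- c3 <= walk mu [seq v i | i <- enum 'I_n] 0.
  rewrite walkE.
  have -> : \sum_(u | form v u == 0) weight mu u = \sum_(u | rel u m) w u.
    by apply: eq_bigl => u; rewrite formv subr_eq0.
  have wS2_ge : p%:R ^- c2.+1 <= wS / 2.
    by apply: le_trans (half_ge _) _; rewrite ler_wpM2r // invr_ge0.
  apply: (invX_le_trans p_gt1 _ wS2_ge relm); last by apply: sumr_ge0.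
  rewrite card_ffun !card_ord expnM leq_exp2r //.
  apply: (@leq_trans (4 * p ^ D0)); last first.
    by rewrite expnD mulnC leq_mul2l (@leq_exp2r 2 p 2) // p_gt1 orbT.
  have : (0 < p ^ D0)%N by rewrite expn_gt0 p_gt0.
  by clear; lia.
have [E [Ep [h' [r [M' [/andP[M'0 _] rc3 co]]]]]] := inv2 p pp2 n v 0 n_gt0 conc_v.
exists (fun x => (m x)%:Z - (p ^ D0)%:Z); split => [x|].
  apply: leq_trans (leK D0 _); last by rewrite /K; clear; lia.
  by have := ltn_ord (m x); clear; lia.
exists E, h', r, M'; split=> //.
  by apply: leq_trans rc3 _; rewrite /K; clear; lia.
move=> /= i /co[m' m'D e]; exists m' => // x; apply: leq_trans (m'D x) (leK _ _).
by rewrite /K; clear; lia.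
Qed.

End BilinearInverse.

Local Open Scope classical_set_scope.
Local Open Scope ring_scope.

(** * From boxes to proper symmetric GAPs *)

Section ProperGap.
Variable R : realType.

Definition in_box r (g : 'I_r -> R) (D : nat) (x : R) :=
  exists2 m : 'I_r -> int, forall h, (`|m h| <= D)%N & x = \sum_h (m h)%:~R * g h.

Lemma in_box_size_le r (g : 'I_r -> R) (D : nat) :
  (in_box g D #<= `I_((2 * D).+1 ^ r))%card.
Proof.
pose L := [seq \sum_h ((m h)%:Z - D%:Z)%:~R * g h | m : {ffun 'I_r -> 'I_(2 * D).+1}].
have sL : size L = ((2 * D).+1 ^ r)%N by rewrite size_map -cardE card_ffun !card_ord.
rewrite -sL; apply: (card_le_trans _ (card_image_le (nth 0 L) `I_(size L))).
apply: subset_card_le => x [m mD ->].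
pose m' : {ffun 'I_r -> 'I_(2 * D).+1} := [ffun h => inord `|m h + D%:Z|].
have xL : \sum_h (m h)%:~R * g h \in L.
  apply/mapP; exists m'; first by rewrite mem_enum.
  apply: eq_bigr => h _; rewrite ffunE inordK; last by have := mD h; lia.
  by congr (_ %:~R * _); have := mD h; lia.
exists (index (\sum_h (m h)%:~R * g h) L); first by rewrite /= index_mem.
exact: nth_index.
Qed.

(* A coincidence sum_h c_h g_h = 0 with c_h0 != 0 expresses every point
   through the r - 1 generators g_h / c_h0. *)
Lemma in_box_proper_gap r (g : 'I_r -> R) (D : nat) : (0 < D)%N ->
  exists G : sym_gap R, [/\ gap_proper G, (gap_rank G <= r)%N,
    gap_size_le G ((4 * D) ^ (2 ^ r * r)) & in_box g D `<=` gap_set G].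
Proof.
elim: r g D => [|r IH] g D D_gt0; pose G := SymGap g (fun=> D).
all: have [pG|npG] := EM (gap_proper G).
- exists G; split=> //; last by move=> x [m mD ->]; exists m.
  rewrite muln0 expn0.
  apply: card_le_trans (in_box_size_le g D).
  by apply: subset_card_le => x [m mD <-]; exists m.
- case: npG => m m' _ _ _; apply/funext => -[]//.
- exists G; split=> //; last by move=> x [m mD ->]; exists m.
  have inG : gap_set G `<=` in_box g D by move=> x [m mD <-]; exists m.
  apply: card_le_trans (subset_card_le inG) (card_le_trans (in_box_size_le g D) _).
  rewrite card_le_II expnM leq_exp2r //.
  apply: (@leq_trans (4 * D)); first by lia.
  by rewrite -[leqLHS]expn1 leq_pexp2l ?expn_gt0 //; lia.
have [c [h0 [c0 cD cg]]] : exists (c : 'I_r.+1 -> int) (h0 : 'I_r.+1),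
    [/\ c h0 != 0, forall h, (`|c h| <= 2 * D)%N & \sum_h (c h)%:~R * g h = 0].
  move: npG => /existsNP[m /existsNP[m' /not_implyP[mD /not_implyP[mD' /not_implyP[e ne]]]]].
  have [h0 mh0] : exists h, m h != m' h.
    apply: contrapT => all_eq; apply: ne; apply/funext => h.
    by apply/eqP; apply: contrapT => /negP ?; apply: all_eq; exists h.
  exists (fun h => m h - m' h), h0; rewrite subr_eq0; split=> // [h|].
    by have := set_mem mD h; have := set_mem mD' h; rewrite /G /=; lia.
  move: e; rewrite /gap_val /= => e0; transitivity
    (\sum_h (m h)%:~R * g h - \sum_h (m' h)%:~R * g h); last by rewrite e0 subrr.
  by rewrite -sumrB; apply: eq_bigr => h _; rewrite rmorphB mulrBl.
have cR0 : (c h0)%:~R != 0 :> R by rewrite intr_eq0.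
(* The new coefficients [m_h * c_h0 - m_h0 * c_h] are bounded by [2 * (D * 2 * D)]. As
   [4 * (4 * D ^ 2) = (4 * D) ^ 2], the exponent in the size bound doubles with each lost
   generator. *)
have [G' [pG' rG' sG' inG']] := IH (fun h => g (lift h0 h) / (c h0)%:~R) (4 * D ^ 2)%N
  ltac:(by rewrite muln_gt0 expn_gt0 D_gt0).
exists G'; split=> //; first exact: leqW.
  apply: card_le_trans sG' _; rewrite card_le_II.
  have -> : (4 * (4 * D ^ 2) = (4 * D) ^ 2)%N by rewrite expnMn mulnA.
  rewrite -expnM leq_pexp2l ?muln_gt0 // mulnA -expnS leq_mul2l leqnSn; exact: orbT.
move=> _ [m mD ->]; apply: inG'.
exists (fun h => m (lift h0 h) * c h0 - m h0 * c (lift h0 h)) => [h|].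
  have [b1 b2 b3 b4] : [/\ `|m (lift h0 h)| <= D, `|m h0| <= D, `|c h0| <= 2 * D &
    `|c (lift h0 h)| <= 2 * D]%N by split.
  have := leq_mul b1 b3; have := leq_mul b2 b4; rewrite -!abszM -mulnn.
  lia.
rewrite (bigD1_ord h0) //=; move: cg; rewrite (bigD1_ord h0) //= => cg.
have -> : g h0 = - (\sum_i (c (lift h0 i))%:~R * g (lift h0 i)) / (c h0)%:~R.
  apply: (mulfI cR0); rewrite [RHS]mulrC divfK //.
  by apply/eqP; rewrite -subr_eq0 opprK cg.
rewrite mulNr mulrN mulr_suml mulr_sumr -sumrN -big_split /=.
apply: eq_bigr => h _; rewrite rmorphB !rmorphM /=; by field.
Qed.

End ProperGap.

(** * Reduction from random variables to finite outcomes *)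

Section Discretization.
Context {d : measure_display} {T : measurableType d} {R : realType}.
Variables (P : probability T R) (mu : R).

Lemma fsum_finType (X : finType) (G : pred X) (f : X -> \bar R) :
  (\sum_(t | G t) f t = \sum_(t \in [set` G]) f t)%E.
Proof.
apply: bigfs; first exact: index_enum_uniq.
by move=> t _; rewrite mem_index_enum.
Qed.

Lemma prob_le_sum (X : finType) (G : pred X) (F : X -> set T) (A : set T) :
  (forall t, measurable (F t)) -> measurable A ->
  (forall w, A w -> exists2 t, G t & F t w) ->
  (P A <= \sum_(t | G t) P (F t))%E.
Proof.
by move=> mF mA AF; rewrite fsum_finType; apply: content_sub_fsum.
Qed.

Lemma copy_of_eta_atom (X : {RV P >-> R}) c : copy_of_eta mu X ->
  P (X @^-1` [set eta_val R c]) = (eta_wt mu c)%:E.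
Proof.
move=> [X1 XN1 X0]; rewrite /eta_wt /eta_val.
case: c => -[|[|[|]]] //= _; first by rewrite sub0r.
  by rewrite subrr.
by have -> : 2%:R - 1 = 1 :> R by rewrite -natr1 addrK.
Qed.

Lemma measurable_preimage (X : {RV P >-> R}) (B : set R) :
  measurable B -> measurable (X @^-1` B).
Proof. by move=> mB; exact: measurable_funPTI. Qed.

Lemma measurable_eta_range : measurable (range (@eta_val R)).
Proof.
apply: countable_measurable; first by move=> x; exact: measurable_set1.
apply: finite_set_countable; apply: finite_image; exact: finite_finset.
Qed.

Lemma eta_val_inj : injective (@eta_val R).
Proof. by move=> c c' /addIr/eqP; rewrite eqr_nat => /eqP/val_inj. Qed.

Lemma copy_of_eta_null (X : {RV P >-> R}) : copy_of_eta mu X ->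
  P (X @^-1` (~` range (@eta_val R))) = 0%E.
Proof.
move=> eX; have mr := measurable_preimage X measurable_eta_range.
rewrite preimage_setC probability_setC //.
suff -> : P (X @^-1` range (@eta_val R)) = 1%E by rewrite subee.
have -> : X @^-1` range (@eta_val R) =
    \bigcup_(c in [set` predT]) X @^-1` [set eta_val R c].
  apply/seteqP; split=> w /=; first by move=> [c _ e]; exists c.
  by move=> [c _ /= e]; exists c.
rewrite measure_fin_bigcup.
- rewrite -fsum_finType -(eta_wt_sum1 mu) -sumEFin.
  by apply: eq_bigr => c _; exact: copy_of_eta_atom.
- exact: finite_finpred.
- move=> c c' _ _ [w [/= e e']]; exact: eta_val_inj (etrans (esym e) e').
- by move=> c _; apply: measurable_preimage; exact: measurable_set1.
Qed.

Section Bilinear.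
Variables (n : nat) (A : 'M[R]_n) (x y : 'I_n -> {RV P >-> R}).
Hypotheses (hx : forall i, copy_of_eta mu (x i)) (hy : forall j, copy_of_eta mu (y j)).
Hypothesis hindep : mutually_independent (joint_family x y).

Let outcome := ({ffun 'I_n -> 'I_3} * {ffun 'I_n -> 'I_3})%type.
Let val_of (uv : outcome) (k : 'I_n + 'I_n) : 'I_3 :=
  match k with inl i => uv.1 i | inr j => uv.2 j end.
Let atom (uv : outcome) : set T :=
  \bigcap_(k in [set` [set: 'I_n + 'I_n]%SET]) (joint_family x y k @^-1` [set eta_val R (val_of uv k)]).

Lemma copy_of_eta_joint k : copy_of_eta mu (joint_family x y k).
Proof. by case: k. Qed.

Lemma atom_prob uv : P (atom uv) = (weight mu uv.1 * weight mu uv.2)%:E.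
Proof.
rewrite /atom (hindep [set: _]%SET); last by move=> k; exact: measurable_set1.
rewrite (eq_bigl xpredT); last by move=> k; rewrite finset.in_setT.
under eq_bigr => k _ do rewrite (copy_of_eta_atom _ (copy_of_eta_joint k)).
by rewrite -(big_morph _ (@EFinM R) erefl) big_sumType.
Qed.

(** A union bound: the event is covered by the atoms of the outcomes solving the equation and by the
    null events that some variable leaves {-1, 0, 1}. *)
Lemma prob_bilinear_le a :
  (P [set w | (\sum_(i < n) \sum_(j < n) A i j * x i w * y j w = a)%R]
    <= (weight_bilinear mu A a)%:E)%E.
Proof.
pose F (t : outcome + ('I_n + 'I_n)) : set T :=
  match t with inl uv => atom uv
  | inr k => joint_family x y k @^-1` (~` range (@eta_val R)) end.
pose G (t : outcome + ('I_n + 'I_n)) :=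
  if t is inl uv then form (fun j => form (A^~ j) uv.1) uv.2 == a else true.
have mF t : measurable (F t).
  case: t => [uv|k] /=; last first.
    by apply: measurable_preimage; apply: measurableC; exact: measurable_eta_range.
  apply: fin_bigcap_measurable; first exact: finite_finpred.
  by move=> k _; apply: measurable_preimage; exact: measurable_set1.
have mE : measurable [set w | \sum_(i < n) \sum_(j < n) A i j * x i w * y j w = a].
  have mf : measurable_fun setT (fun w => \sum_(i < n) \sum_(j < n) A i j * x i w * y j w).
    apply: measurable_sum => i; apply: measurable_sum => j.
    apply: measurable_funM; last exact: measurable_funPT.
    apply: measurable_funM; last exact: measurable_funPT.
    exact: measurable_cst.
  have := mf measurableT [set a] (measurable_set1 a); by rewrite setTI.
have EF w : [set w | \sum_(i < n) \sum_(j < n) A i j * x i w * y j w = a] w ->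
    exists2 t, G t & F t w.
  move=> /= Ew; have [[k kw]|none] := EM (exists k, ~ range (@eta_val R) (joint_family x y k w)).
    by exists (inr k).
  have /choice[c cw] k : exists c, eta_val R c = joint_family x y k w.
    have [[c _ <-]|nr] := EM (range (@eta_val R) (joint_family x y k w)); first by exists c.
    by case: none; exists k.
  exists (inl ([ffun i => c (inl i)], [ffun j => c (inr j)])); last first.
    by move=> [i|j] _ /=; rewrite ffunE cw.
  apply/eqP; rewrite -Ew /form exchange_big /=; apply: eq_bigr => j _.
  rewrite ffunE (cw (inr j)) mulr_suml; apply: eq_bigr => i _.
  by rewrite ffunE (cw (inl i)).
apply: le_trans (prob_le_sum mF mE EF) _.
rewrite big_sumType /= [X in (_ + X)%E]big1 ?adde0; last first.
  by move=> k _; apply: copy_of_eta_null; exact: copy_of_eta_joint.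
under eq_bigr => uv _ do rewrite atom_prob.
rewrite sumEFin lee_fin /weight_bilinear.
under [leRHS]eq_bigr => u _ do rewrite mulr_sumr.
by rewrite pair_big_dep.
Qed.

(** Passing to [s / 2] makes the inequality strict, so that the supremum yields a value [a] without
    being attained. *)
Lemma bilinear_concentration_discrete (s : R) : 0 < s ->
  (s%:E <= bilinear_concentration A x y)%E ->
  exists a, s / 2 <= weight_bilinear mu A a.
Proof.
move=> s_gt0 sb.
have : ((s / 2)%:E < bilinear_concentration A x y)%E.
  by apply: lt_le_trans sb; rewrite lte_fin; lra.
move=> /ereal_sup_gt[_ [a _ <-]] lt; exists a.
by rewrite -lee_fin (le_trans (ltW lt)) // prob_bilinear_le.
Qed.

End Bilinear.
End Discretization.

(** * Assembling the sets, integers and GAPs of the conclusion *)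

Section Conclusion.
Variable R : realType.

Definition gap_columns (eps : R) (K n : nat) (A : 'M[R]_n) :=
  exists (J0 J : {set 'I_n}) (l : int),
    [/\ (#|J0| <= K)%N,
        n%:R - 3 * n%:R `^ eps <= #|J|%:R :> R,
        J :&: J0 = finset.set0,
        l != 0 /\ (`|l| <= n ^ K)%N
      & forall j, j \in J ->
        exists (Pj : sym_gap R) (Ij : {set 'I_n}) (lj : 'I_n -> int),
          [/\ gap_proper Pj,
              (gap_rank Pj <= K)%N /\ gap_size_le Pj (n ^ K),
              n%:R - n%:R `^ eps <= #|Ij|%:R :> R,
              forall j0, j0 \in J0 -> (`|lj j0| <= n ^ K)%N
            & forall i, i \in Ij ->
                gap_set Pj (\sum_(j0 in J0) (lj j0)%:~R * A i j0 + l%:~R * A i j)]].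

Lemma gap_size_le_trans (G : sym_gap R) s t :
  (s <= t)%N -> gap_size_le G s -> gap_size_le G t.
Proof. by move=> st Gs; apply: card_le_trans Gs _; rewrite card_le_II. Qed.

Lemma card_setC_ge n (E : {set 'I_n}) (B : R) :
  #|E|%:R <= B -> n%:R - B <= #|~: E|%:R.
Proof.
move=> EB; have : #|E|%:R + #|~: E|%:R = n%:R :> R by rewrite -natrD cardsC card_ord.
lra.
Qed.

(** For bounded [n] each column lies in the box generated by its own [n] entries with coefficients
    at most 1. *)
Lemma gap_columns_bounded (eps : R) (n0 K n : nat) (A : 'M[R]_n) :
  (2 * (2 ^ n0 * n0) + n0 <= K)%N -> (0 < n <= n0)%N -> gap_columns eps K A.
Proof.
move=> n0K /andP[n_gt0 nn0].
have powK : (0 < n ^ K)%N by rewrite expn_gt0 n_gt0.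
(* For [n = 1] the bound [n ^ K] is 1 and dominates no larger constant; the empty [J] is admissible
   because [1 - 3 <= 0]. *)
have [n1|n_neq1] := eqVneq n 1%N.
  exists finset.set0, finset.set0, 1; split; rewrite ?cards0 ?finset.set0I //.
    by rewrite n1 powR1; lra.
  by move=> j; rewrite inE.
have n_ge2 : (2 <= n)%N by rewrite ltn_neqAle eq_sym n_neq1.
exists finset.set0, [set: 'I_n]%SET, 1; split; rewrite ?cards0 ?finset.setI0 //.
  by rewrite cardsT card_ord gerBl mulr_ge0 ?powR_ge0.
move=> j _; have [G [pG rG sG inG]] := in_box_proper_gap (fun i => A i j) (ltn0Sn 0).
exists G, [set: 'I_n]%SET, (fun=> 0); split=> //.
- split; first by apply: leq_trans rG (leq_trans nn0 _); apply: leq_trans n0K; rewrite leq_addl.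
  apply: gap_size_le_trans sG; apply: (@leq_trans (2 ^ (2 * (2 ^ n0 * n0)))).
    by rewrite -[(4 * 1)%N]/(2 ^ 2)%N -expnM leq_exp2l // leq_mul2l /= leq_mul // leq_exp2l.
  apply: (@leq_trans (2 ^ K)); first by rewrite leq_exp2l // (leq_trans _ n0K) ?leq_addr.
  by rewrite leq_exp2r //; lia.
- by rewrite cardsT card_ord gerBl powR_ge0.
- move=> i _; rewrite finset.big_set0 add0r mul1r; apply: inG.
  exists (fun h => (h == i)%:Z) => [h|]; first by case: eqP.
  rewrite (bigD1 i) //= eqxx mul1r big1 ?addr0 // => h /negbTE ->; exact: mul0r.
Qed.

Lemma gap_columns_large (eps : R) (p K0 K n : nat) (A : 'M[R]_n) :
  (1 < p)%N -> (K0 <= p <= n)%N -> (p ^ 6)%:R <= n%:R `^ eps ->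
  ((K0 + 2) * (2 ^ K0 * K0) + K0.+1 <= K)%N ->
  columns_in_small_gaps A p K0 -> gap_columns eps K A.
Proof.
move=> p_gt1 /andP[K0p pn] p6 K0K [b [M [h [bad [bK /andP[M_gt0 Mp] badp cols]]]]].
have p_gt0 : (0 < p)%N := ltnW p_gt1.
have pow_le e : (e <= K)%N -> (p ^ e <= n ^ K)%N.
  move=> eK; apply: (@leq_trans (p ^ K)); first by rewrite leq_pexp2l.
  by case: (K) => // k; rewrite leq_exp2r.
have K0K' : (K0 < K)%N by apply: leq_trans K0K; rewrite leq_addl.
pose J0 : {set 'I_n} := [set h x | x : 'I_b].
have J0b : (#|J0| <= b)%N by rewrite (leq_trans (leq_imset_card _ _)) // card_ord.
exists J0, (~: (bad :|: J0)), M%:Z; split.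
- exact: leq_trans J0b (leq_trans bK (ltnW K0K')).
(* [bad] has at most [2 * p ^ 6] elements and [J0] at most [K0 <= p <= p ^ 6]. *)
- apply: card_setC_ge; apply: (@le_trans _ _ (3 * (p ^ 6)%:R)); last by rewrite ler_wpM2l.
  rewrite -natrM ler_nat (leq_trans (leq_card_setU _ _)) //.
  rewrite -[3%N]/(2 + 1)%N mulnDl mul1n leq_add // (leq_trans J0b) //.
  by rewrite (leq_trans bK) // (leq_trans K0p) // -[leqLHS]expn1 leq_pexp2l.
- by rewrite finset.setCU -finset.setIA [X in _ :&: X]finset.setIC finset.setICr finset.setI0.
- by split; [lia | exact: leq_trans Mp (pow_le _ (ltnW K0K'))].
move=> j; rewrite finset.in_setC finset.in_setU negb_or => /andP[/cols[m [mp]]] + _.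
move=> [E [h' [r [M' [Ep M'_gt0 rK co]]]]].
move: co => /=; set v := fun i => _; move=> co.
have D_gt0 : (0 < p ^ K0)%N by rewrite expn_gt0 p_gt0.
have [G [pG rG sG inG]] := in_box_proper_gap (fun x : 'I_r => v (h' x) / M'%:R)
  (D_gt0 : (0 < p ^ K0)%N).
(* Several [x] may share the index [h x], so their coefficients are added; there are at most
   [K0 <= p] of them, whence the bound [p ^ K0.+1]. *)
exists G, (~: E), (fun j0 => - \sum_(x | h x == j0) m x); split=> //.
- split; first exact: leq_trans rG (leq_trans rK (ltnW K0K')).
  apply: gap_size_le_trans sG.
  apply: (@leq_trans ((p ^ (K0 + 2)) ^ (2 ^ K0 * K0))); last first.
    by rewrite -expnM pow_le // (leq_trans _ K0K) ?leq_addr.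
  apply: (@leq_trans ((p ^ (K0 + 2)) ^ (2 ^ r * r))).
    have [->|r_gt0] := posnP r; first by rewrite !muln0.
    rewrite leq_exp2r ?muln_gt0 ?expn_gt0 // expnD mulnC leq_mul2l.
    by rewrite (@leq_exp2r 2 p 2) // p_gt1 orbT.
  by rewrite leq_pexp2l ?expn_gt0 ?p_gt0 // leq_mul // leq_exp2l.
- by apply: card_setC_ge; apply: le_trans p6; rewrite ler_nat.
- move=> j0 _; rewrite abszN; apply: leq_trans (pow_le K0.+1 K0K').
  rewrite -lez_nat abszE; apply: le_trans (ler_norm_sum _ _ _) _.
  apply: (@le_trans _ _ (\sum_(x : 'I_b) (p ^ K0)%N%:Z)).
    rewrite big_mkcond; apply: ler_sum => x _; case: ifP => // _.
    by rewrite -abszE lez_nat.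
  rewrite sumr_const card_ord -mulr_natl natz -PoszM lez_nat expnS leq_mul2r.
  by rewrite (leq_trans bK) // orbT.
- move=> i; rewrite finset.in_setC => /co[m' m'p e]; apply: inG.
  exists (fun x : 'I_r => m' x) => [x|]; first exact: m'p.
  have M'_neq0 : M'%:R != 0 :> R by rewrite pnatr_eq0 -lt0n.
  transitivity (v i).
    rewrite /v -[M%:~R]/(M%:R) addrC; congr (_ + _).
    rewrite [in RHS](partition_big h (mem J0)) /=; last first.
      by move=> x _; apply: imset_f.
    rewrite -sumrN; apply: eq_bigr => j0 _.
    rewrite rmorphN mulNr rmorph_sum mulr_suml; congr (- _).
    by apply: eq_big => x //= /eqP ->.
  apply: (mulfI M'_neq0); rewrite e mulr_sumr; apply: eq_bigr => x _.
  by field.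
Qed.

End Conclusion.

(** * Choice of the scale [p] as a power of [n] *)

Section Scale.
Variables (R : realType) (eps : R).
Hypotheses (eps_gt0 : 0 < eps) (eps_le1 : eps <= 1).

(** Take [p] as the integer part of [t = n ^ (eps / 6)], so that [p ^ 6 <= n ^ eps]. *)
Lemma power_scale : exists d : nat, forall p1 n : nat, (1 < p1)%N ->
  (p1 ^ d <= n)%N -> exists p : nat,
  [/\ (p1 <= p <= n)%N, (n <= p ^ d)%N & (p ^ 6)%:R <= n%:R `^ eps].
Proof.
pose d := Num.bound (12 / eps).
have d_ge : 12 <= d%:R * eps.
  by rewrite -ler_pdivrMr // ltW // archi_boundP // divr_ge0 ?ltW.
exists d => p1 n p1_gt1 p1n.
have n_gt0 : (0 < n)%N by apply: leq_trans p1n; rewrite expn_gt0 ltnW.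
have n_ge1 : (1 : R) <= n%:R by rewrite ler1n.
pose t := n%:R `^ (eps / 6).
have t_ge0 : 0 <= t by exact: powR_ge0.
have /andP[] := truncn_itv t_ge0; set p := Num.truncn t => pt tp.
have p1t : p1%:R <= t.
  have p1_ge1 : (1 : R) <= p1%:R by rewrite ler1n ltnW.
  apply: (@le_trans _ _ ((p1 ^ d)%:R `^ (eps / 6))).
    rewrite natrX -powR_mulrn // -powRrM -[leLHS]powRr1 // ler_powR //; lra.
  by rewrite ge0_ler_powR ?nnegrE ?ler0n ?ler_nat ?divr_ge0 // ltW.
have p1p : (p1 <= p)%N by rewrite -ltnS -(ltr_nat R); exact: le_lt_trans tp.
have p_gt1 : (1 < p)%N := leq_trans p1_gt1 p1p.
have p6 : (p ^ 6)%:R <= n%:R `^ eps.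
  have -> : n%:R `^ eps = t ^+ 6.
    by rewrite -powR_mulrn // -powRrM divfK // pnatr_eq0.
  by rewrite natrX lerXn2r ?nnegrE ?ler0n.
exists p; split=> //.
  rewrite p1p /= -(ler_nat R).
  apply: (@le_trans _ _ (p ^ 6)%:R); first by rewrite ler_nat -[leqLHS]expn1 leq_pexp2l // ltnW.
  by apply: le_trans p6 _; rewrite -[leRHS]powRr1 ?ler0n // ler_powR.
rewrite -(ler_nat R) natrX.
have p_ge1 : (1 : R) <= p%:R by rewrite ler1n ltnW.
(* Rounding costs a square, [t < p + 1 <= p ^ 2]; hence [d >= 12 / eps] rather than [6 / eps]. *)
have tp2 : t <= p%:R ^+ 2.
  apply: le_trans (ltW tp) _; rewrite -natrX ler_nat -mulnn.
  by rewrite (@leq_trans (2 * p)) ?leq_mul2r ?p_gt1 ?orbT //; lia.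
have -> : n%:R = t `^ (6 / eps) :> R.
  by rewrite -powRrM mulrA divfK ?divff ?powRr1 ?gt_eqF ?ler0n.
apply: (@le_trans _ _ ((p%:R ^+ 2) `^ (6 / eps))).
  by rewrite ge0_ler_powR ?nnegrE ?exprn_ge0 ?divr_ge0 // ltW.
rewrite -[p%:R ^+ 2]powR_mulrn // -[leRHS]powR_mulrn // -powRrM ler_powR //.
by rewrite mulrA -natrM ler_pdivrMr.
Qed.

(** Converts the hypothesis into a power of [p]; the additional factor [p >= 2] absorbs the 1/2 lost
    in [bilinear_concentration_discrete]. *)
Lemma inv_powR_lower (C : R) (d p n : nat) : 0 < C -> (1 < p)%N -> (0 < n <= p ^ d)%N ->
  p%:R ^- (d * Num.bound C).+1 <= n%:R `^ (- C) / 2.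
Proof.
move=> C_gt0 p_gt1 /andP[n_gt0 npd].
have p_gt0 : (0 : R) < p%:R by rewrite ltr0n ltnW.
have nR : (0 : R) < n%:R by rewrite ltr0n.
rewrite powRN exprSr invfM; apply: ler_pM; rewrite ?invr_ge0 ?exprn_ge0 ?ler0n //.
  rewrite lef_pV2 ?posrE ?powR_gt0 ?exprn_gt0 // exprM -natrX.
  have pd_ge1 : (1 : R) <= (p ^ d)%:R by rewrite ler1n expn_gt0 ltnW.
  apply: (@le_trans _ _ ((p ^ d)%:R `^ C)).
    by rewrite ge0_ler_powR ?nnegrE ?ler0n ?ler_nat // ltW.
  by rewrite -powR_mulrn ?ler0n // ler_powR // ltW // archi_boundP // ltW.
by rewrite lef_pV2 ?posrE // ler_nat.
Qed.

End Scale.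

Theorem theorem7p4 (R : realType) (eps mu C : R)
    (heps0 : 0 < eps) (heps1 : eps <= 1)
    (hmu0 : 0 < mu) (hmu1 : mu <= 1) (hC : 0 < C) :
  exists K : nat,
  forall (n : nat) (hn : (0 < n)%N) (A : 'M[R]_n)
    (d : measure_display) (T : measurableType d) (P : probability T R)
    (x y : 'I_n -> {RV P >-> R})
    (hx : forall i, copy_of_eta mu (x i))
    (hy : forall j, copy_of_eta mu (y j))
    (hindep : mutually_independent (joint_family x y))
    (hrho : ((n%:R `^ (- C))%:E <= bilinear_concentration A x y)%E),
  exists (J0 J : {set 'I_n}) (l : int),
    [/\ (#|J0| <= K)%N,
        n%:R - 3 * n%:R `^ eps <= #|J|%:R :> R,
        J :&: J0 = finset.set0,
        l != 0 /\ (`|l| <= n ^ K)%N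
      & forall j, j \in J ->
        exists (Pj : sym_gap R) (Ij : {set 'I_n}) (lj : 'I_n -> int),
          [/\ gap_proper Pj,
              (gap_rank Pj <= K)%N /\ gap_size_le Pj (n ^ K),
              n%:R - n%:R `^ eps <= #|Ij|%:R :> R,
              forall j0, j0 \in J0 -> (`|lj j0| <= n ^ K)%N
            & forall i, i \in Ij ->
                gap_set Pj (\sum_(j0 in J0) (lj j0)%:~R * A i j0 + l%:~R * A i j)]].
Proof.
have [d param] := power_scale heps0 heps1.
have [p0 [K0 inv]] := bilinear_inverse hmu0 hmu1 (d * Num.bound C).+1 d.
(* Above [n0] the scale satisfies [p >= p1], hence exceeds every threshold; the finitely many
   [n <= n0] are covered by enlarging [K]. *)
pose p1 := maxn 2 (maxn p0 K0); pose n0 := (p1 ^ d)%N.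
exists (maxn (2 * (2 ^ n0 * n0) + n0) ((K0 + 2) * (2 ^ K0 * K0) + K0.+1)).
move=> n n_gt0 A disp T P x y hx hy hindep hrho.
have [n_small|n_large] := leqP n n0.
  by apply: (@gap_columns_bounded R eps n0); rewrite ?leq_maxl ?n_gt0.
have [p [/andP[p1p pn] npd p6]] := param p1 n (leq_maxl _ _) (ltnW n_large).
move: (p1p); rewrite !geq_max => /and3P[p_gt1 p0p K0p].
apply: (@gap_columns_large R eps p K0) => //; rewrite ?leq_maxr ?K0p //.
have nC_gt0 : 0 < n%:R `^ (- C) by rewrite powR_gt0 // ltr0n.
have [z hz] := bilinear_concentration_discrete hx hy hindep nC_gt0 hrho.
apply: (inv p p0p n A z); first by rewrite n_gt0.
by apply: le_trans hz; apply: inv_powR_lower; rewrite ?n_gt0.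
Qed.
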